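(* Let $k\ge 9$ and $r\ge 3$ be integers, let $A$ be a $4k\times 4k$ binary matrix and let $P$ be an $r$-repetition-free $k$-permutation matrix. If $A$ has at most $(k/3)(k/r)^{1/3}$ $0$-entries, then $A$ contains $P$.
   Context: A $k$-permutation matrix is a $k\times k$ binary matrix with exactly one $1$-entry in every row and every column. A binary matrix $A$ contains a binary matrix $B$ if $B$ can be obtained from $A$ by deleting some rows, some columns, and changing some $1$-entries to $0$-entries. The distance vector from the $1$-entry at $(i_1,j_1)$ to the $1$-entry at $(i_2,j_2)$ is $(i_2-i_1,j_2-j_1)$. A vector is $r$-repeated in $P$ if it is the distance vector of at least $r$ pairs of $1$-entries of $P$; $P$ is $r$-repetition-free if no vector is $r$-repeated in $P$. *)

(* Defs.v *)
From HB Require Import structures.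
From mathcomp Require Import all_boot all_order all_algebra.
From mathcomp Require Import reals exp.

Set Implicit Arguments.
Unset Strict Implicit.
Unset Printing Implicit Defensive.

Import Order.TTheory GRing.Theory Num.Theory.
Local Open Scope ring_scope.

Definition ones m n (A : 'M[bool]_(m, n)) : {set 'I_m * 'I_n} :=
  [set e | A e.1 e.2].

Definition zeros m n (A : 'M[bool]_(m, n)) : {set 'I_m * 'I_n} :=
  [set e | ~~ A e.1 e.2].

Definition permutation_matrix k (P : 'M[bool]_k) : Prop :=
  (forall i, #|[set j | P i j]| = 1%N) /\ (forall j, #|[set i | P i j]| = 1%N).

(* The strictly increasing maps f and g select the rows and the columns that
   are not deleted. *)
Definition contains m n p q (A : 'M[bool]_(m, n)) (B : 'M[bool]_(p, q)) : Prop :=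
  exists (f : 'I_p -> 'I_m) (g : 'I_q -> 'I_n),
    [/\ {homo f : i j / (i < j)%N}, {homo g : i j / (i < j)%N} &
        forall i j, B i j ==> mxsub f g A i j].

Definition distance_vector m n (e1 e2 : 'I_m * 'I_n) : int * int :=
  ((e2.1 : nat)%:Z - (e1.1 : nat)%:Z, (e2.2 : nat)%:Z - (e1.2 : nat)%:Z).

(* A pair consists of two distinct 1-entries: otherwise the zero vector would
   be the distance vector of every entry to itself, hence repeated k times in
   every k-permutation matrix. *)
Definition repeated (r : nat) m n (P : 'M[bool]_(m, n)) (v : int * int) : Prop :=
  (r <= #|[set e : ('I_m * 'I_n) * ('I_m * 'I_n) |
            [&& e.1 \in ones P, e.2 \in ones P, e.1 != e.2 &
                distance_vector e.1 e.2 == v]]|)%N.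

Definition repetition_free (r : nat) m n (P : 'M[bool]_(m, n)) : Prop :=
  forall v, ~ repeated r P v.

(* Main.v *)
(** Let D be the integer part of (k/r)^(1/3)/3, so that 27 r D^3 <= k.  Deleting
    the k rows and the k columns of A with the most 0-entries leaves a 3k x 3k
    matrix with at most D 0-entries in each line.  Cut the rows of P into strips
    of D+1 consecutive rows, leave a gap of D rows between consecutive strips,
    and translate the result by (a, b).  Inside a strip, each row of P may use
    either its own place or the place D rows below.  If the first row of the
    strip meeting a 0-entry at its own place is i, then the rows above i stay,
    the rows below i move down by D, and row i chooses freely among D+1 rows,
    one of which has a 1-entry in the required column.  This fails only if some
    later row of the strip meets a 0-entry after moving down.  Such a clash
    consists of two 0-entries of A, at most 3k D * D^2 pairs in all, whose
    distance vector, once corrected by (D, 0), is a distance vector of P; hence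
    each pair spoils fewer than r translations, which is less than their number
    in total. *)
Require Import Defs.
From HB Require Import structures.
From mathcomp Require Import all_boot all_order all_algebra.
From mathcomp Require Import reals exp.
From mathcomp Require Import zify ring.

Set Implicit Arguments.
Unset Strict Implicit.
Unset Printing Implicit Defensive.

Import Order.TTheory GRing.Theory Num.Theory.
Local Open Scope ring_scope.

(** * Submatrices with few 0-entries in every line *)

Lemma increasing_enumeration n p (S : {set 'I_n}) : (p <= #|S|)%N ->
  exists2 h : 'I_p -> 'I_n,
    {homo h : i j / (i < j)%N} & forall i, h i \in S.
Proof.
move=> le_pS; pose h (i : 'I_p) := enum_val (widen_ord le_pS i).
exists h => [i j lt_ij|i]; last exact: enum_valP.
have tr : transitive (relpre (val : 'I_n -> nat) ltn).
  by move=> x y z; apply: ltn_trans.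
have srt : sorted (relpre (val : 'I_n -> nat) ltn) (enum S).
  rewrite {1}/enum_mem; apply: sorted_filter => //.
  rewrite -enumT; move: (iota_ltn_sorted 0 n).
  by rewrite -val_enum_ord sorted_map.
have dflt : 'I_n := h i.
rewrite /h !(enum_val_nth dflt).
by apply: (sorted_ltn_nth tr dflt srt) => //; rewrite inE -cardE ltn_ord.
Qed.

Lemma card_pair_set (S T : finType) (Q : pred (S * T)) :
  #|[set p | Q p]| = (\sum_x #|[set y | Q (x, y)]|)%N.
Proof.
rewrite -sum1dep_card (eq_bigr (fun x => \sum_(y | Q (x, y)) 1)%N); last first.
  by move=> x _; rewrite sum1dep_card.
by rewrite pair_big_dep /=; apply: eq_bigl => -[].
Qed.

Lemma card_zeros_rows m n (A : 'M[bool]_(m, n)) :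
  #|zeros A| = (\sum_i #|[set j | ~~ A i j]|)%N.
Proof. by rewrite /zeros card_pair_set. Qed.

Lemma card_zeros_tr m n (A : 'M[bool]_(m, n)) : #|zeros A^T| = #|zeros A|.
Proof.
rewrite -(card_imset _ (can_inj (@swap_pairK 'I_m 'I_n))).
apply: eq_card => -[i j]; rewrite inE mxE /=.
apply/idP/imsetP => [Aij|[[x y]]]; first by exists (j, i); rewrite ?inE.
by rewrite inE => Axy [-> ->].
Qed.

(** If more than [k] rows had at least [D.+1] 0-entries each, they would hold at least [D.+1 * k.+1]
    of them. *)
Lemma light_rows m n p k D (A : 'M[bool]_(m, n)) :
    (#|zeros A| < D.+1 * k.+1)%N -> (p + k <= m)%N ->
  exists2 h : 'I_p -> 'I_m, {homo h : i j / (i < j)%N} &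
    forall i, (#|[set j | ~~ A (h i) j]| <= D)%N.
Proof.
move=> ltz le_pk.
pose L := [set i | (#|[set j | ~~ A i j]| <= D)%N].
have heavy : (D.+1 * #|~: L| <= #|zeros A|)%N.
  rewrite card_zeros_rows (bigID (mem (~: L))) /= mulnC -sum_nat_const.
  rewrite (leq_trans _ (leq_addr _ _)) //; apply: leq_sum => i.
  by rewrite !inE -ltnNge.
have le_k : (#|~: L| <= k)%N.
  by rewrite -ltnS -(ltn_pmul2l (ltn0Sn D)) (leq_ltn_trans heavy).
have le_pL : (p <= #|L|)%N by move: (cardsC L); rewrite card_ord; lia.
have [h h_inc hL] := increasing_enumeration le_pL.
by exists h => // i; move: (hL i); rewrite inE.
Qed.

Lemma homo_ltn_inj m n (h : 'I_m -> 'I_n) :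
  {homo h : i j / (i < j)%N} -> injective h.
Proof.
move=> h_inc i j eq_h; apply: val_inj => /=.
by case: (ltngtP i j) => // /h_inc; rewrite eq_h ltnn.
Qed.

(** Rows and columns can be selected independently, both by their counts in the whole of [A],
    because deleting lines only lowers the counts of the others. *)
Lemma sparse_submatrix n p k D (A : 'M[bool]_n) :
    (#|zeros A| < D.+1 * k.+1)%N -> (p + k <= n)%N ->
  exists (f g : 'I_p -> 'I_n),
    [/\ {homo f : i j / (i < j)%N}, {homo g : i j / (i < j)%N},
        forall i, (#|[set j | ~~ mxsub f g A i j]| <= D)%N &
        forall j, (#|[set i | ~~ mxsub f g A i j]| <= D)%N].
Proof.
move=> ltz le_pn; have [f f_inc fL] := light_rows ltz le_pn.
rewrite -card_zeros_tr in ltz; have [g g_inc gL] := light_rows ltz le_pn.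
exists f, g; split => // [i|j].
  apply: leq_trans (fL i).
  rewrite -(card_imset _ (homo_ltn_inj g_inc)); apply: subset_leq_card.
  by apply/subsetP=> _ /imsetP[j + ->]; rewrite !inE mxE.
apply: leq_trans (gL j).
rewrite -(card_imset _ (homo_ltn_inj f_inc)); apply: subset_leq_card.
by apply/subsetP=> _ /imsetP[i + ->]; rewrite !inE !mxE.
Qed.

Lemma contains_mxsub m n p q m' n' (f : 'I_p -> 'I_m) (g : 'I_q -> 'I_n)
    (A : 'M[bool]_(m, n)) (B : 'M[bool]_(m', n')) :
    {homo f : i j / (i < j)%N} -> {homo g : i j / (i < j)%N} ->
  contains (mxsub f g A) B -> contains A B.
Proof.
move=> f_inc g_inc [f' [g' [f'_inc g'_inc AB]]].
exists (f \o f'), (g \o g'); split=> [i j /f'_inc/f_inc//|i j /g'_inc/g_inc//|].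
by move=> i j; move: (AB i j); rewrite !mxE.
Qed.

(** * Numerical bounds and counts of 0-entries *)

Lemma card_ord_interval n lo D :
  (#|[set x : 'I_n | lo < x <= lo + D]| <= D)%N.
Proof.
rewrite cardE -(size_map val) -[leqRHS](size_iota lo.+1).
apply: uniq_leq_size; first by rewrite (map_inj_uniq val_inj) enum_uniq.
by move=> _ /mapP[x + ->]; rewrite mem_enum inE mem_iota addSn ltnS.
Qed.

(** With m the cube root of k/r and D the floor of m/3, the first bound is r(3D)^3 <= r m^3 = k and
    the second is k m/3 <= k(D+1). *)
Lemma cube_root_bound (R : realType) (k r z : nat) : (0 < r)%N ->
    z%:R <= k%:R / 3 * (k%:R / r%:R) `^ (1 / 3) :> R ->
  exists D, (27 * (r * D ^ 3) <= k)%N /\ (z <= D.+1 * k)%N.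
Proof.
move=> r_gt0; set m := _ `^ _ => zle.
have m3 : m ^+ 3 = k%:R / r%:R.
  rewrite -powR_mulrn ?powR_ge0 // -powRrM mul1r.
  by rewrite mulVf ?pnatr_eq0 // powRr1 // divr_ge0.
have m_ge0 : 0 <= m / 3 by rewrite divr_ge0 ?powR_ge0.
have [D /andP[Dle Dgt]] : exists D : nat, D%:R <= m / 3 < D.+1%:R.
  by eexists; apply: truncn_itv.
exists D; split; last first.
  rewrite -(ler_nat R) natrM (le_trans zle) // mulrAC -mulrA mulrC.
  by rewrite ler_wpM2r // ltW.
have m3r : m ^+ 3 * r%:R = k%:R by rewrite m3 divfK // pnatr_eq0 -lt0n.
have D3 : D%:R ^+ 3 <= (m / 3) ^+ 3 :> R by rewrite lerXn2r ?nnegrE ?ler0n.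
rewrite -(ler_nat R) -m3r natrM natrM natrX mulrCA mulrC.
rewrite ler_wpM2r ?ler0n // mulrC -ler_pdivlMr ?ltr0n //.
by rewrite (le_trans D3) // expr_div_n -natrX.
Qed.

(* Natural-number indices; false outside the matrix. *)
Definition zero_at m n (A : 'M[bool]_(m, n)) (x y : nat) : bool :=
  [exists e in zeros A, (x == e.1 :> nat) && (y == e.2 :> nat)].

Lemma zero_atE m n (A : 'M[bool]_(m, n)) (i : 'I_m) (j : 'I_n) :
  zero_at A i j = ~~ A i j.
Proof.
apply/exists_inP/idP => [[[i' j']]|Aij]; last by exists (i, j); rewrite ?inE ?eqxx.
by rewrite inE /= => Aij /andP[/eqP/val_inj-> /eqP/val_inj->].
Qed.

(** Pigeonhole: [D.+1] consecutive places of a column cannot all be 0-entries. *)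
Lemma column_gap m n D (A : 'M[bool]_(m, n)) (x : nat) (j : 'I_n) :
    (#|[set i | ~~ A i j]| <= D)%N -> (x + D < m)%N ->
  exists t, (t <= D)%N && ~~ zero_at A (x + t) j.
Proof.
move=> leD ltm; have ltx (t : 'I_D.+1) : (x + t < m)%N by case: t => t /=; lia.
have [/existsP[t Ht]|/existsPn H] :=
  boolP [exists t : 'I_D.+1, ~~ zero_at A (x + t) j].
  by exists t; rewrite Ht -ltnS ltn_ord.
have h_inj : injective (fun t => Ordinal (ltx t)).
  by move=> t u [] /eqP; rewrite eqn_add2l => /eqP/val_inj.
suff : (D.+1 <= #|[set i | ~~ A i j]|)%N by rewrite ltnNge leD.
rewrite -[X in (X <= _)%N]card_ord -(card_imset _ h_inj).
apply: subset_leq_card; apply/subsetP => _ /imsetP[t _ ->].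
by rewrite inE -zero_atE -[zero_at _ _ _]negbK H.
Qed.

Lemma card_zeros_le m n D (A : 'M[bool]_(m, n)) :
  (forall i, #|[set j | ~~ A i j]| <= D)%N -> (#|zeros A| <= m * D)%N.
Proof.
move=> leD; rewrite card_zeros_rows -[m in (m * D)%N]card_ord -sum_nat_const.
exact: leq_sum.
Qed.

(** Once the first 0-entry of a clash is fixed, this bounds the choices for the second. *)
Lemma card_zeros_strip m n D lo (A : 'M[bool]_(m, n)) :
    (forall i, #|[set j | ~~ A i j]| <= D)%N ->
  (#|[set e in zeros A | lo < e.1 <= lo + D]| <= D * D)%N.
Proof.
move=> leD; pose I := [set x : 'I_m | (lo < x <= lo + D)%N].
rewrite card_pair_set; apply: (@leq_trans (\sum_(x in I) D)%N); last first.
  by rewrite sum_nat_const leq_mul2r card_ord_interval orbT.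
rewrite [leqRHS]big_mkcond leq_sum // => i _; case: ifPn => iI.
  apply: leq_trans (leD i); apply: subset_leq_card.
  by apply/subsetP => j; rewrite !inE => /andP[].
rewrite leqn0 cards_eq0; apply/eqP/setP => j; rewrite !inE /=.
by move: iI; rewrite inE => /negbTE->; rewrite andbF.
Qed.

(** * Positions of the stretched rows *)

(* Row of the i-th row of P once gaps of D rows separate its strips. *)
Definition stretch D i := (i + D * (i %/ D.+1))%N.

Lemma stretch_le D i : (stretch D i <= i + i)%N.
Proof.
rewrite leq_add2l (leq_trans _ (leq_trunc_div i D.+1)) // mulnC leq_mul2l.
by rewrite leqnSn orbT.
Qed.

(** Between different strips the gap of [D] rows absorbs any offset up to [D]; only inside a strip
    must the offsets be monotone. *)
Lemma ltn_stretch D i j e e' : (i < j)%N -> (e <= D)%N ->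
    (i %/ D.+1 = j %/ D.+1 -> e <= e')%N ->
  (stretch D i + e < stretch D j + e')%N.
Proof.
move=> lt_ij leD le_e; have := leq_div2r D.+1 (ltnW lt_ij).
rewrite /stretch leq_eqVlt => /orP[/eqP eq_ij|]; first by move: (le_e eq_ij); lia.
move: (i %/ _)%N (j %/ _)%N => u v lt_uv; have : (D * u.+1 <= D * v)%N.
  by rewrite leq_mul2l lt_uv orbT.
by rewrite mulnS; lia.
Qed.

Lemma stretch_sub D i j : (i %/ D.+1 = j %/ D.+1)%N -> (i < j)%N ->
  (stretch D i < stretch D j <= stretch D i + D)%N.
Proof.
rewrite /stretch => eq_ij lt_ij; rewrite eq_ij.
by move: (divn_eq i D.+1) (divn_eq j D.+1) (ltn_pmod j (ltn0Sn D)); lia.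
Qed.

(** * Counting the translations with a clash *)

Lemma repetition_free_card r m n (P : 'M[bool]_(m, n)) v :
    repetition_free r P ->
  (#|[set e : ('I_m * 'I_n) * ('I_m * 'I_n) |
      [&& e.1 \in ones P, e.2 \in ones P, e.1 != e.2 &
          distance_vector e.1 e.2 == v]]| < r)%N.
Proof. by move=> /(_ v)/negP; rewrite -ltnNge. Qed.

(* The permutation matrix has its 1-entry of row i in column s i. *)
Definition clash D m n (A : 'M[bool]_(m, n)) k (s : 'I_k -> 'I_k) (a b : nat) :=
  [exists i : 'I_k, exists j : 'I_k,
    [&& (i < j)%N, (i %/ D.+1 == j %/ D.+1)%N,
        zero_at A (a + stretch D i) (b + s i) &
        zero_at A (a + (stretch D j + D)) (b + s j)]].

(** Double counting: at most [m * D] choices for the upper 0-entry, then [D * D] for the lower one,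
    then fewer than [r] pairs of 1-entries of [P] with the prescribed vector. *)
Lemma card_clash D r k m n p q (P : 'M[bool]_k) (s : 'I_k -> 'I_k)
    (A : 'M[bool]_(m, n)) :
    (forall i, P i (s i)) -> repetition_free r P ->
    (forall i, #|[set j | ~~ A i j]| <= D)%N ->
  (#|[set ab : 'I_p.+1 * 'I_q.+1 | clash D A s ab.1 ab.2]|
     <= m * D * (D * D) * r)%N.
Proof.
move=> Ps freeP leD.
(* Stretching preserves row differences inside a strip, so removing the downward move by [D]
   recovers a distance vector of [P]. *)
pose vec (e : ('I_m * 'I_n) * ('I_m * 'I_n)) : int * int :=
  ((e.2.1 : nat)%:Z - (e.1.1 : nat)%:Z - D%:Z, (e.2.2 : nat)%:Z - (e.1.2 : nat)%:Z).
pose near (e e' : 'I_m * 'I_n) :=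
  [&& e \in zeros A, e' \in zeros A & (e.1 + D < e'.1 <= e.1 + D + D)%N].
pose dist (d : ('I_k * 'I_k) * ('I_k * 'I_k)) v :=
  [&& d.1 \in ones P, d.2 \in ones P, d.1 != d.2 & distance_vector d.1 d.2 == v].
pose Q := [set w | near w.1.1 w.1.2 && dist w.2 (vec w.1)].
have leQ : (#|Q| <= m * D * (D * D) * r)%N.
  rewrite card_pair_set.
  apply: (@leq_trans (\sum_(e in [set e | near e.1 e.2]) r)%N).
    rewrite [leqRHS]big_mkcond leq_sum // => e _; rewrite inE.
    case: ifPn => He.
      apply: leq_trans (ltnW (repetition_free_card (vec e) freeP)).
      by apply: subset_leq_card; apply/subsetP => d; rewrite !in_set => /andP[_].
    by rewrite leqn0 cards_eq0; apply/eqP/setP => d; rewrite !inE.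
  rewrite sum_nat_const leq_mul2r; apply/orP; right.
  rewrite card_pair_set; apply: (@leq_trans (\sum_(e in zeros A) D * D)%N).
    rewrite [leqRHS]big_mkcond leq_sum // => e _; case: ifPn => He.
      apply: leq_trans (card_zeros_strip (e.1 + D) leD).
      apply: subset_leq_card; apply/subsetP => e'.
      by rewrite in_set => /and3P[_ e'A lte]; rewrite in_set e'A.
    rewrite leqn0 cards_eq0; apply/eqP/setP => e'.
    by rewrite in_set0 in_set; apply/negP => /and3P[/(negP He)].
  by rewrite sum_nat_const leq_mul2r card_zeros_le ?orbT.
(* A clash determines the translation (a, b). *)
pose psi (w : (('I_m * 'I_n) * ('I_m * 'I_n)) * (('I_k * 'I_k) * ('I_k * 'I_k))) :
    'I_p.+1 * 'I_q.+1 :=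
  (inord (w.1.1.1 - stretch D w.2.1.1), inord (w.1.1.2 - w.2.1.2)).
apply: leq_trans leQ; apply: leq_trans (leq_imset_card psi _).
apply: subset_leq_card; apply/subsetP => -[a b]; rewrite inE /=.
move=> /existsP[i /existsP[j /and4P[lt_ij /eqP eq_ij]]].
move=> /exists_inP[[x y] zxy /= /andP[/eqP ex /eqP ey]].
move=> /exists_inP[[x' y'] zxy' /= /andP[/eqP ex' /eqP ey']].
apply/imsetP; exists (((x, y), (x', y')), ((i, s i), (j, s j))); last first.
  rewrite /psi /= -ex -ey !addnK.
  by congr pair; apply: val_inj; rewrite /= inordK.
have /andP[lt_st le_st] := stretch_sub eq_ij lt_ij.
rewrite inE /= /near zxy zxy' /= -ex -ex' /dist !inE /= !Ps /=.
apply/and3P; split; first by apply/andP; split; lia.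
  by rewrite xpair_eqE negb_and -val_eqE /= neq_ltn lt_ij.
rewrite /distance_vector /vec /= -ex -ex' -ey -ey' xpair_eqE /stretch eq_ij.
by apply/andP; split; lia.
Qed.

(** * Embedding [P] by a translation without clash *)

Lemma contains_of_no_clash D k m n (P : 'M[bool]_k) (A : 'M[bool]_(m, n))
    (s : 'I_k -> 'I_k) (a b : nat) :
    (forall i j, P i j -> j = s i) ->
    (forall j, #|[set i | ~~ A i j]| <= D)%N ->
    (a + (k + k) + D <= m.+1)%N -> (b + k <= n)%N -> ~~ clash D A s a b ->
  contains A P.
Proof.
move=> sP leD le_am le_bn ok.
have ltn_col (j : 'I_k) : (b + j < n)%N by have := ltn_ord j; lia.
have ltn_row (i : 'I_k) t : (t <= D)%N -> (a + (stretch D i + t) < m)%N.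
  by have := ltn_ord i; have := stretch_le D i; lia.
pose g j := Ordinal (ltn_col j).
have gap (i : 'I_k) :
    exists t, (t <= D)%N && ~~ zero_at A (a + stretch D i + t) (b + s i).
  apply: (@column_gap _ _ _ _ _ (g (s i))) => //.
  by rewrite -addnA ltn_row.
pose hit (i : 'I_k) := zero_at A (a + stretch D i) (b + s i).
pose late (i : 'I_k) :=
  [exists j : 'I_k, [&& (j < i)%N, (j %/ D.+1 == i %/ D.+1)%N & hit j]].
(* The least admissible offset is 0 unless the row itself is hit, so this one formula covers both
   the rows above the first hit of a strip and the row of that hit. *)
pose e i := if late i then D else ex_minn (gap i).
have e_le i : (e i <= D)%N.
  by rewrite /e; case: ifP => // _; case: ex_minnP => t /andP[].
have e_mono (i j : 'I_k) : (i < j)%N -> (i %/ D.+1 = j %/ D.+1)%N ->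
    (e i <= e j)%N.
  move=> lt_ij eq_ij; have [late_j|not_late_j] := boolP (late j).
    by rewrite {2}/e late_j.
  have not_hit_i : ~~ hit i.
    apply: contra not_late_j => hit_i; apply/existsP; exists i.
    by rewrite lt_ij eq_ij eqxx.
  have not_late_i : ~~ late i.
    apply: contra not_late_j => /existsP[l /and3P[lt_li /eqP eq_li hit_l]].
    by apply/existsP; exists l; rewrite (ltn_trans lt_li) // eq_li eq_ij eqxx.
  rewrite {1}/e (negbTE not_late_i); case: ex_minnP => t _ t_min.
  by rewrite (leq_trans (t_min 0 _)) // addn0.
have e_ok (i : 'I_k) : ~~ zero_at A (a + (stretch D i + e i)) (b + s i).
  rewrite /e; case: ifPn => [late_i|_]; last first.
    by case: ex_minnP => t /andP[_]; rewrite addnA.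
  apply: contra ok => hit_i; have [j /and3P[lt_ji eq_ji hit_j]] := existsP late_i.
  by apply/existsP; exists j; apply/existsP; exists i; rewrite lt_ji eq_ji hit_i andbT.
exists (fun i => Ordinal (ltn_row i _ (e_le i))), g; split.
- by move=> i j lt_ij /=; rewrite ltn_add2l ltn_stretch // => /e_mono->.
- by move=> i j lt_ij /=; rewrite ltn_add2l.
- move=> i j; apply/implyP => /sP->; rewrite mxE -[A _ _]negbK -zero_atE.
  exact: e_ok.
Qed.

Lemma sparse_contains k r D (P : 'M[bool]_k) (A : 'M[bool]_(3 * k)) :
    (0 < k)%N -> (0 < r)%N -> (27 * (r * D ^ 3) <= k)%N ->
    (forall i, #|[set j | P i j]| = 1)%N -> repetition_free r P ->
    (forall i, #|[set j | ~~ A i j]| <= D)%N ->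
    (forall j, #|[set i | ~~ A i j]| <= D)%N ->
  contains A P.
Proof.
move=> k_gt0 r_gt0 leDk rowsP freeP rowsA colsA.
have rowP i : exists j, [set j | P i j] == [set j].
  by have /eqP/cards1P[j ->] := rowsP i; exists j.
pose s i := xchoose (rowP i).
have sP i j : P i j = (j == s i).
  by have /eqP/setP/(_ j) := xchooseP (rowP i); rewrite !inE.
set X := (r * D ^ 3)%N in leDk.
(* This turns [27 * X <= k] into [26 * X <= k - D]. *)
have le_DX : (D <= X)%N.
  rewrite (leq_trans _ (leq_pmull _ _)) // -[leqLHS]expn1.
  by case: (D) => // D'; rewrite leq_pexp2l.
(* Of the [3 * k] rows, fewer than [2 * k] go to the stretched rows and [D] to the downward moves,
   which leaves [a <= k - D]; the [k] columns of [P] leave [b <= 2 * k]. *)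
have cardB := @card_clash D r k _ _ (k - D) (2 * k) P s A _ freeP rowsA.
have [[a b] /= ok|all_clash] := pickP [pred ab : 'I_(k - D).+1 * 'I_(2 * k).+1 |
                     ~~ clash D A s ab.1 ab.2].
  apply: contains_of_no_clash colsA _ _ ok.
  - by move=> i j; rewrite sP => /eqP.
  - by have := ltn_ord a; lia.
  - by have := ltn_ord b; lia.
exfalso; move: cardB.
have -> : [set ab : 'I_(k - D).+1 * 'I_(2 * k).+1 | clash D A s ab.1 ab.2] = setT.
  by apply/setP => ab'; rewrite !inE; have /negbFE := all_clash ab'.
rewrite cardsT card_prod !card_ord => /(_ (fun i => etrans (sP i _) (eqxx _))).
apply/negP; rewrite -ltnNge.
have -> : (3 * k * D * (D * D) * r = X * (3 * k))%N by rewrite /X; ring.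
(* The left factor is a lower bound for the number of values of [a]; the product already exceeds the
   [X * (3 * k)] possible clashes. *)
apply: (@leq_trans ((26 * X).+1 * (2 * k).+1)); last by rewrite leq_mul2r; lia.
nia.
Qed.

Theorem theorem4p3 (R : realType) (k r : nat) (A : 'M[bool]_(4 * k))
    (P : 'M[bool]_k) (hk : (9 <= k)%N) (hr : (3 <= r)%N)
    (permP : permutation_matrix P) (freeP : repetition_free r P)
    (zerosA : #|zeros A|%:R <= k%:R / 3 * (k%:R / r%:R) `^ (1 / 3) :> R) :
  contains A P.
Proof.
have r_gt0 : (0 < r)%N by apply: leq_trans hr.
have k_gt0 : (0 < k)%N by apply: leq_trans hk.
have [D [leDk leD]] := cube_root_bound r_gt0 zerosA.
have lt_zeros : (#|zeros A| < D.+1 * k.+1)%N.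
  by rewrite (leq_ltn_trans leD) // ltn_pmul2l.
have [|f [g [f_inc g_inc rowsB colsB]]] := @sparse_submatrix _ (3 * k) _ _ _ lt_zeros.
  by rewrite -mulSnr.
apply: contains_mxsub f_inc g_inc _.
exact: sparse_contains leDk permP.1 freeP rowsB colsB.
Qed.
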